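(* Let $P,P',P'',Q,S$ be programs and $B$ a Boolean expression such that $P'\equiv_B(P,B)$ and $P''\equiv_B(P,\neg B)$. If the operational triple $\{|P'|\}\ S\ \{|Q|\}$ holds and $P''\sqsubseteq Q$, then $\{|P|\}\ \mathbf{if}\ B\ \mathbf{then}\ S\ \mathbf{fi}\ \{|Q|\}$ holds.
   Context: Programs are statements of a sequential imperative language with a standard small-step operational semantics over program states. $\mathrm{behs}(P)$ is the set of pairs (initial state, final state) of finite terminating executions of $P$; $(s,u)\in\mathrm{behs}(P;Q)$ iff there is $t$ with $(s,t)\in\mathrm{behs}(P)$ and $(t,u)\in\mathrm{behs}(Q)$. For a state $s$ and Boolean expression $B$, $s(B)\in\{\mathit{tt},\mathit{ff}\}$ is the (side-effect-free) value of $B$ in $s$. The statement $\mathbf{if}\ B\ \mathbf{then}\ S\ \mathbf{fi}$ started in state $s$ executes $S$ from $s$ if $s(B)=\mathit{tt}$ and otherwise terminates in $s$ without changing the state. The post-state set is $\mathrm{pst}(P)=\{t:\exists s,\ (s,t)\in\mathrm{behs}(P)\}$. Program ordering: $P\sqsubseteq Q$ iff $\mathrm{pst}(P)\subseteq\mathrm{pst}(Q)$. The operational triple $\{|P|\}\ S\ \{|Q|\}$ means $\mathrm{pst}(P;S)\subseteq\mathrm{pst}(Q)$. For programs $P',P$ and Boolean expression $B$, $P'\equiv_B(P,B)$ means $\mathrm{pst}(P')=\mathrm{pst}(P)\cap\{s : s(B)=\mathit{tt}\}$. *)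

(* Defs.v *)
From Stdlib Require Import ZArith.
Open Scope Z_scope.

Definition state := nat -> Z.

Inductive aexp : Type :=
  | ANum (n : Z) | AVar (x : nat)
  | APlus (a1 a2 : aexp) | AMinus (a1 a2 : aexp) | AMult (a1 a2 : aexp).

Fixpoint aeval (s : state) (a : aexp) : Z :=
  match a with
  | ANum n => n
  | AVar x => s x
  | APlus a1 a2 => aeval s a1 + aeval s a2
  | AMinus a1 a2 => aeval s a1 - aeval s a2
  | AMult a1 a2 => aeval s a1 * aeval s a2
  end.

Inductive bexp : Type :=
  | BTrue | BFalse
  | BEq (a1 a2 : aexp) | BLe (a1 a2 : aexp)
  | BNot (b : bexp) | BAnd (b1 b2 : bexp) | BOr (b1 b2 : bexp).

Fixpoint beval (s : state) (b : bexp) : bool :=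
  match b with
  | BTrue => true
  | BFalse => false
  | BEq a1 a2 => Z.eqb (aeval s a1) (aeval s a2)
  | BLe a1 a2 => Z.leb (aeval s a1) (aeval s a2)
  | BNot b => negb (beval s b)
  | BAnd b1 b2 => andb (beval s b1) (beval s b2)
  | BOr b1 b2 => orb (beval s b1) (beval s b2)
  end.

Definition update (s : state) (x : nat) (v : Z) : state :=
  fun y => if Nat.eqb y x then v else s y.

Inductive stmt : Type :=
  | Skip
  | Assign (x : nat) (a : aexp)
  | Seq (c1 c2 : stmt)
  | IfThenElse (b : bexp) (c1 c2 : stmt)
  | IfThen (b : bexp) (c : stmt)
  | While (b : bexp) (c : stmt).

Inductive step : stmt * state -> stmt * state -> Prop :=
  | st_assign : forall x a s, step (Assign x a, s) (Skip, update s x (aeval s a))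
  | st_seq_skip : forall c s, step (Seq Skip c, s) (c, s)
  | st_seq : forall c1 c1' c2 s s',
      step (c1, s) (c1', s') -> step (Seq c1 c2, s) (Seq c1' c2, s')
  | st_ite_true : forall b c1 c2 s,
      beval s b = true -> step (IfThenElse b c1 c2, s) (c1, s)
  | st_ite_false : forall b c1 c2 s,
      beval s b = false -> step (IfThenElse b c1 c2, s) (c2, s)
  | st_if_true : forall b c s,
      beval s b = true -> step (IfThen b c, s) (c, s)
  | st_if_false : forall b c s,
      beval s b = false -> step (IfThen b c, s) (Skip, s)
  | st_while : forall b c s,
      step (While b c, s) (IfThenElse b (Seq c (While b c)) Skip, s).

Inductive steps : stmt * state -> stmt * state -> Prop :=
  | steps_refl : forall cf, steps cf cf
  | steps_step : forall cf1 cf2 cf3, step cf1 cf2 -> steps cf2 cf3 -> steps cf1 cf3.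

Definition behs (P : stmt) (s t : state) : Prop := steps (P, s) (Skip, t).

Definition pst (P : stmt) (t : state) : Prop := exists s, behs P s t.

Definition prog_le (P Q : stmt) : Prop := forall t, pst P t -> pst Q t.

Definition op_triple (P S Q : stmt) : Prop := forall t, pst (Seq P S) t -> pst Q t.

Definition equivB (P' P : stmt) (B : bexp) : Prop :=
  forall t, pst P' t <-> (pst P t /\ beval t B = true).

(* Main.v *)
(* Run P to a post-state m. If m satisfies B, then m is a post-state of P', and the
   conditional behaves as S, so the triple for P' applies. Otherwise m is a post-state
   of P'', the conditional leaves m unchanged, and P'' ⊑ Q applies. *)
Require Import Defs.

Lemma steps_from_Skip (s t : state) (c : stmt) :
  steps (Skip, s) (c, t) -> c = Skip /\ t = s.
Proof.
  intros H; inversion H as [|? ? ? Hstep]; subst; [auto | inversion Hstep].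
Qed.

Lemma steps_Seq (c1 c2 : stmt) (s t : state) (cf : stmt * state) :
  steps (c1, s) (Skip, t) -> steps (c2, t) cf -> steps (Seq c1 c2, s) cf.
Proof.
  intros H1 H2.
  remember (c1, s) as cf1 eqn:E1; remember (Skip, t) as cf2 eqn:E2.
  revert c1 s E1.
  induction H1 as [|cf1 [c1' s'] cf3 Hstep _ IH]; intros c1 s E1; subst.
  - injection E1 as <- <-. eapply steps_step; [constructor | exact H2].
  - eapply steps_step; [apply st_seq; exact Hstep | now apply IH].
Qed.

Lemma steps_Seq_inv (c1 c2 : stmt) (s u : state) :
  steps (Seq c1 c2, s) (Skip, u) ->
  exists t, steps (c1, s) (Skip, t) /\ steps (c2, t) (Skip, u).
Proof.
  intros H.
  remember (Seq c1 c2, s) as cf eqn:E; remember (Skip, u) as cf' eqn:E'.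
  revert c1 s E.
  induction H as [|cf1 cf2 cf3 Hstep Hrest IH]; intros c1 s E; subst; [discriminate|].
  inversion Hstep; subst.
  - exists s; split; [constructor | exact Hrest].
  - destruct (IH eq_refl _ _ eq_refl) as (t & Ht1 & Ht2).
    exists t; split; [eapply steps_step; eassumption | exact Ht2].
Qed.

Lemma pst_Seq (c1 c2 : stmt) (u : state) :
  pst (Seq c1 c2) u <-> exists t, pst c1 t /\ behs c2 t u.
Proof.
  split.
  - intros [s Hs].
    destruct (steps_Seq_inv _ _ _ _ Hs) as (t & Ht1 & Ht2).
    exists t; split; [exists s |]; assumption.
  - intros (t & [s Hs] & Ht). exists s. eapply steps_Seq; eassumption.
Qed.

Lemma behs_IfThen_inv (b : bexp) (c : stmt) (s u : state) :
  behs (IfThen b c) s u ->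
  (beval s b = true /\ behs c s u) \/ (beval s b = false /\ u = s).
Proof.
  intros H; inversion H as [|? ? ? Hstep Hrest]; subst.
  inversion Hstep; subst.
  - now left.
  - right; split; [assumption | now apply steps_from_Skip in Hrest].
Qed.

Theorem theorem4 (P P' P'' Q S : stmt) (B : bexp) :
  equivB P' P B ->
  equivB P'' P (BNot B) ->
  op_triple P' S Q ->
  prog_le P'' Q ->
  op_triple P (IfThen B S) Q.
Proof.
  intros HP' HP'' HS HQ u Hu.
  apply pst_Seq in Hu as (m & Hm & Hif).
  destruct (behs_IfThen_inv _ _ _ _ Hif) as [[HB Hbody] | [HnB ->]].
  - apply HS, pst_Seq. exists m. split; [now apply HP' | exact Hbody].
  - apply HQ, HP''. split; [exact Hm | simpl; now rewrite HnB].
Qed.
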